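(* For any dimension $d$, every unital quantum channel $\tau$ on $\mathbb{M}_d$ admits a real-weighted integral representation over the family of twisted dephasing channels $\beta_{U,V}$, explicitly $$\tau=\int_{U,V\in\mathbb{U}(d)}\Big((d-1)(d+1)^2\langle\beta_{U,V},\tau\rangle-(d-1)(d+1)^2+1\Big)\beta_{U,V}\,\mathrm{d}U\,\mathrm{d}V.$$
   Context: $\mathbb{M}_d$ is the algebra of $d\times d$ complex matrices and $\mathbb{U}(d)$ its unitary group; $\mathrm{d}U$, $\mathrm{d}V$ denote the normalized Haar measure on $\mathbb{U}(d)$. A quantum channel on $\mathbb{M}_d$ is a completely positive, trace-preserving linear map. $\mathrm{Ad}_U(X)=UXU^*$; $\Delta_d(X)=\sum_{j=1}^d\langle e_j,Xe_j\rangle|e_j\rangle\langle e_j|$ with $\{e_j\}$ the standard basis of $\mathbb{C}^d$; for $U,V\in\mathbb{U}(d)$, $\beta_{U,V}=\mathrm{Ad}_U\circ\Delta_d\circ\mathrm{Ad}_{V^*}$ is a twisted dephasing channel. $\mathbb{M}_d$ carries the Hilbert-Schmidt inner product $\langle X,Y\rangle=\mathrm{Tr}(X^*Y)$, and linear maps on $\mathbb{M}_d$ carry the corresponding Hilbert-Schmidt inner product $\langle\varphi,\psi\rangle=\mathrm{Tr}(\varphi^*\circ\psi)$ (trace of a linear operator on the $d^2$-dimensional space $\mathbb{M}_d$, with $\varphi^*$ the adjoint). *)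

(* Defs.v *)
From HB Require Import structures.
From mathcomp Require Import all_boot all_order all_algebra.
From mathcomp Require Import all_classical all_reals all_analysis.
From mathcomp Require Import spectral complex.

Set Implicit Arguments.
Unset Strict Implicit.
Unset Printing Implicit Defensive.

Import Order.TTheory GRing.Theory Num.Theory.
Import numFieldNormedType.Exports.

Local Open Scope classical_set_scope.
Local Open Scope ring_scope.
Local Open Scope complex_scope.
Local Open Scope sesquilinear_scope.

(* R[i] carries the topology of its modulus, so that 'M[R[i]]_d carries the
   product topology of its entries. *)
HB.instance Definition _ (R : realType) := PseudoMetric.copy R[i] (R[i])^o.

Section Superoperators.
Variables (R : realType) (d : nat).
Local Notation M := 'M[R[i]]_d.

Definition hs_inner (X Y : M) : R[i] := \tr (X ^t* *m Y).

(* The (i, j) entry of the adjoint of phi at X is forced by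
   <E_ij, phi^* X> = <phi E_ij, X>; see superop_adjP. *)
Definition superop_adj (phi : M -> M) (X : M) : M :=
  \matrix_(i, j) hs_inner (phi (delta_mx i j)) X.

Lemma superop_adjP (phi : {linear M -> M}) (X Y : M) :
  hs_inner (superop_adj phi X) Y = hs_inner X (phi Y).
Proof.
have hsE (A B : M) : hs_inner A B = \sum_i \sum_j (A j i)^*%R * B j i.
  rewrite /hs_inner /mxtrace; apply: eq_bigr => i _.
  by rewrite mxE; apply: eq_bigr => j _; rewrite !mxE.
have hsC (A B : M) : (hs_inner A B)^*%R = hs_inner B A.
  rewrite !hsE rmorph_sum; apply: eq_bigr => i _.
  rewrite rmorph_sum; apply: eq_bigr => j _.
  by rewrite rmorphM /= conjCK mulrC.
rewrite [LHS]hsE [in RHS](matrix_sum_delta Y) exchange_big linear_sum.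
rewrite /hs_inner mulmx_sumr raddf_sum; apply: eq_bigr => i _ /=.
rewrite linear_sum mulmx_sumr raddf_sum; apply: eq_bigr => j _ /=.
by rewrite mxE hsC linearZ -scalemxAr mxtraceZ mulrC.
Qed.

(* lin_mx phi is the d^2 x d^2 matrix of phi in the basis (E_ij). *)
Definition superop_trace (phi : M -> M) : R[i] := \tr (lin_mx phi).

Definition superop_inner (phi psi : M -> M) : R[i] :=
  superop_trace (superop_adj phi \o psi).

Definition psd n (A : 'M[R[i]]_n) : Prop :=
  forall v : 'cV[R[i]]_n, 0 <= (v ^t* *m A *m v) ord0 ord0.

(* id_n (x) phi on n x n block matrices with blocks in M *)
Definition ampliation n (phi : M -> M) (A : 'M[R[i]]_(\sum_(i < n) d)) :
    'M[R[i]]_(\sum_(i < n) d) :=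
  \mxblock_(i < n, j < n) phi (submxblock A i j).

Definition completely_positive (phi : M -> M) : Prop :=
  forall n A, psd A -> psd (@ampliation n phi A).

Definition trace_preserving (phi : M -> M) : Prop :=
  forall X, \tr (phi X) = \tr X.

Definition quantum_channel (phi : {linear M -> M}) : Prop :=
  completely_positive phi /\ trace_preserving phi.

Definition unital (phi : M -> M) : Prop := phi 1%:M = 1%:M.

Definition Ad (U : M) (X : M) : M := U *m X *m U ^t*.

Definition dephasing (X : M) : M := \sum_(j < d) X j j *: delta_mx j j.

Fact Ad_is_linear U : linear (Ad U).
Proof.
by move=> a X Y; rewrite /Ad mulmxDr mulmxDl -scalemxAr -scalemxAl.
Qed.
HB.instance Definition _ U :=
  GRing.isLinear.Build _ _ _ _ (Ad U) (Ad_is_linear U).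

Fact dephasing_is_linear : linear dephasing.
Proof.
move=> a X Y; rewrite /dephasing scaler_sumr -big_split.
by apply: eq_bigr => j _; rewrite !mxE scalerDl scalerA.
Qed.
HB.instance Definition _ :=
  GRing.isLinear.Build _ _ _ _ dephasing dephasing_is_linear.

End Superoperators.

Section UnitaryGroup.
Variables (R : realType) (d : nat).

Definition unitary_set : set 'M[R[i]]_d := [set U | U \is unitarymx].

Definition unitary : Type := set_type unitary_set.

Definition unitary_val (U : unitary) : 'M[R[i]]_d := set_val U.

Lemma unitary_valP (U : unitary) : unitary_val U \is unitarymx.
Proof. exact: (set_valP U). Qed.

Definition mk_unitary (U : 'M[R[i]]_d) (hU : U \is unitarymx) : unitary :=
  exist _ U (mem_set (hU : unitary_set U)).

Lemma unitarymx1 : (1%:M : 'M[R[i]]_d) \is unitarymx.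
Proof. by apply/unitarymxP; rewrite mul1mx trmx1 map_mx1. Qed.

Definition unitary1 : unitary := mk_unitary unitarymx1.

Definition unitary_mul (U V : unitary) : unitary :=
  mk_unitary (mul_unitarymx (unitary_valP U) (unitary_valP V)).

HB.instance Definition _ := Topological.on unitary.
HB.instance Definition _ := isPointed.Build unitary unitary1.
HB.instance Definition _ :=
  Measurable.copy unitary (g_sigma_algebraType (@open unitary)).

(* A probability measure on the Borel sets; left invariance determines it. *)
Definition haar_measure (mu : probability unitary R) : Prop :=
  forall (W : unitary) (A : set unitary), measurable A ->
    mu [set unitary_mul W U | U in A] = mu A.

End UnitaryGroup.

Coercion unitary_val : unitary >-> matrix.

Definition twisted_dephasing (R : realType) (d : nat) (U V : unitary R d) :
    'M[R[i]]_d -> 'M[R[i]]_d :=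
  Ad U \o @dephasing R d \o Ad ((unitary_val V) ^t* ).

Section Integrals.
Variables (R : realType) (disp : measure_display) (T : measurableType disp).
Variable mu : {measure set T -> \bar R}.

Definition cintegrable (f : T -> R[i]) : Prop :=
  mu.-integrable setT (EFin \o (fun x => complex.Re (f x))) /\
  mu.-integrable setT (EFin \o (fun x => complex.Im (f x))).

Definition cintegral (f : T -> R[i]) : R[i] :=
  (\int[mu]_x complex.Re (f x)) +i* (\int[mu]_x complex.Im (f x)).

(* Integrals of families of linear maps on 'M_d, matrix entry by matrix entry *)
Definition superop_integrable d (F : T -> 'M[R[i]]_d -> 'M[R[i]]_d) : Prop :=
  forall X i j, cintegrable (fun x => F x X i j).

Definition superop_integral d (F : T -> 'M[R[i]]_d -> 'M[R[i]]_d)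
    (X : 'M[R[i]]_d) : 'M[R[i]]_d :=
  \matrix_(i, j) cintegral (fun x => F x X i j).

End Integrals.

(* Main.v *)
Require Import Defs.
From HB Require Import structures.
From mathcomp Require Import all_boot all_order all_algebra.
From mathcomp Require Import fingroup perm.
From mathcomp Require Import all_classical all_reals all_analysis.
From mathcomp Require Import measurable_realfun spectral complex ring.

Set Implicit Arguments.
Unset Strict Implicit.
Unset Printing Implicit Defensive.

Import Order.TTheory GRing.Theory Num.Theory.
Import numFieldNormedType.Exports.

Local Open Scope classical_set_scope.
Local Open Scope ring_scope.
Local Open Scope complex_scope.
Local Open Scope sesquilinear_scope.

(* Write Q_j(U) for the projection onto the line of U e_j.  Then
   <beta_{U,V}, tau> = sum_j tr(tau(Q_j(V)) Q_j(U)) and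
   beta_{U,V}(X) = sum_k tr(X Q_k(V)) Q_k(U), so everything reduces to the
   moments E[tr(A Q_j) Q_k] = a_jk tr(A) 1 + b_jk A.  Left invariance suffices
   to compute them: diagonal phases kill every moment
   E[U_aj conj(U_bj) U_ck conj(U_ek)] in which the row indices do not pair up,
   permutation matrices leave three constants, a reflection with rational
   entries relates these, and the relations U^* U = 1 fix the rest.
   Integrating out U and then V turns the average of <beta, tau> beta(X) into
   (sum_jk b_jk^2) tau(X) plus a multiple of tr(X) 1, because tau is trace
   preserving and unital.  Here sum_jk b_jk^2 = 1 / ((d - 1) (d + 1)^2), and the
   remaining multiple of tr(X) 1 is cancelled by the average tr(X)/d 1 of
   beta(X). *)

(** * Integrals of complex-valued functions *)

Section ComplexIntegral.
Context {R : realType} {disp : measure_display} {T : measurableType disp}.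
Implicit Types (f g : T -> R[i]) (c : R[i]).

Lemma ReD (a b : R[i]) : complex.Re (a + b) = complex.Re a + complex.Re b.
Proof. by case: a; case: b. Qed.

Lemma ImD (a b : R[i]) : complex.Im (a + b) = complex.Im a + complex.Im b.
Proof. by case: a; case: b. Qed.

Lemma ReM (a b : R[i]) : complex.Re (a * b) =
  complex.Re a * complex.Re b - complex.Im a * complex.Im b.
Proof. by case: a; case: b. Qed.

Lemma ImM (a b : R[i]) : complex.Im (a * b) =
  complex.Re a * complex.Im b + complex.Im a * complex.Re b.
Proof. by case: a; case: b => /= ? ? ? ?. Qed.

(** Unlike integrability, this property is stable under products. Polynomials in the entries of
    unitary matrices and in their conjugates have it, and it implies integrability for every finite
    measure. *)
Definition bounded_mfun f : Prop :=
  [/\ measurable_fun setT (fun x => complex.Re (f x)),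
      measurable_fun setT (fun x => complex.Im (f x)) &
      exists M : R, forall x,
        `|complex.Re (f x)| <= M /\ `|complex.Im (f x)| <= M].

Lemma bounded_mfun_cst c : bounded_mfun (fun=> c).
Proof.
split; [exact: measurable_cst|exact: measurable_cst|].
exists (Num.max `|complex.Re c| `|complex.Im c|) => _.
by rewrite !le_max !lexx orbT.
Qed.

Lemma bounded_mfunD f g : bounded_mfun f -> bounded_mfun g ->
  bounded_mfun (fun x => f x + g x).
Proof.
move=> [fr fi [M fM]] [gr gi [N gN]]; split.
- by under eq_fun do rewrite ReD; exact: measurable_funD.
- by under eq_fun do rewrite ImD; exact: measurable_funD.
exists (M + N) => x; have [? ?] := fM x; have [? ?] := gN x.
by rewrite ReD ImD; split; apply: le_trans (ler_normD _ _) _; exact: lerD.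
Qed.

Lemma bounded_mfunM f g : bounded_mfun f -> bounded_mfun g ->
  bounded_mfun (fun x => f x * g x).
Proof.
move=> [fr fi [M fM]] [gr gi [N gN]]; split.
- under eq_fun do rewrite ReM.
  by apply: measurable_funB; apply: measurable_funM.
- under eq_fun do rewrite ImM.
  by apply: measurable_funD; exact: measurable_funM.
exists (M * N + M * N) => x; have [? ?] := fM x; have [? ?] := gN x.
rewrite ReM ImM; split.
  by apply: le_trans (ler_normB _ _) _; rewrite !normrM; apply: lerD; exact: ler_pM.
by apply: le_trans (ler_normD _ _) _; rewrite !normrM; apply: lerD; exact: ler_pM.
Qed.

Lemma bounded_mfun_conj f :
  bounded_mfun f -> bounded_mfun (fun x => (f x)^*%R).
Proof.
move=> [fr fi [M fM]].
have E x : (f x)^*%R = complex.Re (f x) -i* complex.Im (f x) by case: (f x).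
split.
- by under eq_fun do rewrite E /=.
- by under eq_fun do rewrite E /=; exact: measurable_funN.
by exists M => x; rewrite E /= normrN; exact: fM.
Qed.

Lemma bounded_mfun_sum (I : Type) (r : seq I) (F : I -> T -> R[i]) :
  (forall i, bounded_mfun (F i)) -> bounded_mfun (fun x => \sum_(i <- r) F i x).
Proof.
move=> FP; elim: r => [|i r IH].
  rewrite (_ : (fun _ => _) = fun=> 0); first exact: bounded_mfun_cst.
  by apply/funext => x; rewrite big_nil.
rewrite (_ : (fun _ => _) = fun x => F i x + \sum_(j <- r) F j x).
  exact: bounded_mfunD.
by apply/funext => x; rewrite big_cons.
Qed.

Lemma bounded_mfun_cintegrable (mu : {measure set T -> \bar R}) f :
  (mu setT < +oo)%E -> bounded_mfun f -> cintegrable mu f.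
Proof.
move=> mu_fin [fr fi [M fM]]; split; apply: measurable_bounded_integrable => //.
- exists M; split=> [|N MN x _]; [exact: num_real|].
  by apply: le_trans (ltW MN); have [] := fM x.
- exists M; split=> [|N MN x _]; [exact: num_real|].
  by apply: le_trans (ltW MN); have [] := fM x.
Qed.

Section Linear.
Variable mu : {measure set T -> \bar R}.

Lemma cintegrableD f g : cintegrable mu f -> cintegrable mu g ->
  cintegrable mu (fun x => f x + g x).
Proof.
move=> [fr fi] [gr gi]; split.
  apply: eq_integrable (integrableD measurableT fr gr) => // x _ /=.
  by rewrite ReD.
apply: eq_integrable (integrableD measurableT fi gi) => // x _ /=.
by rewrite ImD.
Qed.

Lemma cintegralD f g : cintegrable mu f -> cintegrable mu g ->
  cintegral mu (fun x => f x + g x) = cintegral mu f + cintegral mu g.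
Proof.
move=> [fr fi] [gr gi]; rewrite /cintegral.
under eq_Rintegral do rewrite ReD.
under [X in _ +i* X]eq_Rintegral do rewrite ImD.
by rewrite !RintegralD.
Qed.

Lemma cintegrableZ c f : cintegrable mu f ->
  cintegrable mu (fun x => c * f x).
Proof.
move=> [fr fi]; split.
  have := integrableB measurableT (integrableZl measurableT (complex.Re c) fr)
    (integrableZl measurableT (complex.Im c) fi).
  by apply: eq_integrable => // x _ /=; rewrite ReM.
have := integrableD measurableT (integrableZl measurableT (complex.Re c) fi)
    (integrableZl measurableT (complex.Im c) fr).
by apply: eq_integrable => // x _ /=; rewrite ImM.
Qed.

Lemma cintegralZ c f : cintegrable mu f ->
  cintegral mu (fun x => c * f x) = c * cintegral mu f.
Proof.
move=> [fr fi]; rewrite /cintegral.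
under eq_Rintegral do rewrite ReM.
under [X in _ +i* X]eq_Rintegral do rewrite ImM.
have intZ (k : R) (h : T -> R) : mu.-integrable setT (EFin \o h) ->
    mu.-integrable setT (EFin \o (fun x => k * h x)).
  move=> hi; apply: eq_integrable (integrableZl measurableT k hi) => // x _ /=.
rewrite RintegralB ?RintegralD ?RintegralZl //; try exact: intZ.
by apply/eqP; rewrite eq_complex ReM ImM /= !eqxx.
Qed.

Lemma cintegrable0 : cintegrable mu (fun=> 0).
Proof. by split; exact: integrable0. Qed.

Lemma cintegral0 : cintegral mu (fun=> 0) = 0.
Proof. by rewrite /cintegral /Rintegral /= integral0. Qed.

Lemma cintegrable_sum (I : Type) (r : seq I) (F : I -> T -> R[i]) :
  (forall i, cintegrable mu (F i)) ->
  cintegrable mu (fun x => \sum_(i <- r) F i x).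
Proof.
move=> FP; elim: r => [|i r IH].
  rewrite (_ : (fun _ => _) = fun=> 0); first exact: cintegrable0.
  by apply/funext => x; rewrite big_nil.
rewrite (_ : (fun _ => _) = fun x => F i x + \sum_(j <- r) F j x).
  exact: cintegrableD.
by apply/funext => x; rewrite big_cons.
Qed.

Lemma cintegral_sum (I : Type) (r : seq I) (F : I -> T -> R[i]) :
  (forall i, cintegrable mu (F i)) ->
  cintegral mu (fun x => \sum_(i <- r) F i x) = \sum_(i <- r) cintegral mu (F i).
Proof.
move=> FP; elim: r => [|i r IH].
  rewrite (_ : (fun _ => _) = fun=> 0); first by rewrite cintegral0 big_nil.
  by apply/funext => x; rewrite big_nil.
rewrite (_ : (fun _ => _) = fun x => F i x + \sum_(j <- r) F j x).
  by rewrite cintegralD ?IH ?big_cons //; exact: cintegrable_sum.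
by apply/funext => x; rewrite big_cons.
Qed.

End Linear.

Lemma cintegral_cst (mu : probability T R) c : cintegral mu (fun=> c) = c.
Proof.
rewrite /cintegral.
have E r : \int[mu]_x r = r.
  by rewrite Rintegral_cst//= [X in fine X]probability_setT mulr1.
by rewrite !E; case: c.
Qed.

End ComplexIntegral.

(** * Image measures and Fubini's theorem *)

Lemma probability_lty {R : realType} {disp : measure_display}
    {T : measurableType disp} (m : probability T R) : (m setT < +oo)%E.
Proof. by rewrite probability_setT ltry. Qed.

Lemma bounded_mfun_comp {R : realType} {d1 d2 : measure_display}
    {T1 : measurableType d1} {T2 : measurableType d2}
    (h : T1 -> T2) (f : T2 -> R[i]) :
  measurable_fun setT h -> bounded_mfun f -> bounded_mfun (f \o h).
Proof.
move=> mh [fr fi [M fM]]; split.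
- exact: (measurableT_comp fr mh).
- exact: (measurableT_comp fi mh).
by exists M => x; exact: fM.
Qed.

Lemma cintegral_pushforward {R : realType} {d1 d2 : measure_display}
    {T1 : measurableType d1} {T2 : measurableType d2}
    (mu : {measure set T1 -> \bar R}) (nu : {measure set T2 -> \bar R})
    (h : T1 -> T2) (f : T2 -> R[i]) :
  (mu setT < +oo)%E -> measurable_fun setT h ->
  (forall A, measurable A -> nu A = mu (h @^-1` A)) ->
  bounded_mfun f -> cintegral nu f = cintegral mu (f \o h).
Proof.
move=> mu_fin mh nuE bf; have [fr fi _] := bf.
have [ir ii] := bounded_mfun_cintegrable mu_fin (bounded_mfun_comp mh bf).
have E (g : T2 -> R) : measurable_fun setT g ->
    mu.-integrable setT (EFin \o (fun x => g (h x))) ->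
    \int[nu]_x g x = \int[mu]_x g (h x).
  move=> mg ig; congr fine.
  transitivity (\int[pushforward mu h]_y (g y)%:E)%E.
    by apply: eq_measure_integral => A mA _; rewrite /pushforward nuE.
  rewrite integral_pushforward ?preimage_setT //; exact/measurable_EFinP.
by rewrite /cintegral !E.
Qed.

Lemma product_measure1_lty {R : realType} {d1 d2 : measure_display}
    {T1 : measurableType d1} {T2 : measurableType d2}
    (m1 : probability T1 R) (m2 : probability T2 R) :
  ((m1 \x m2) setT < +oo)%E.
Proof.
rewrite -setXTT product_measure1E // -[X in (X * _)%E]/(m1 setT).
by rewrite -[X in (_ * X)%E]/(m2 setT) !probability_setT mule1 ltry.
Qed.

Lemma cintegral_fubini {R : realType} {d1 d2 : measure_display}
    {T1 : measurableType d1} {T2 : measurableType d2}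
    (m1 : probability T1 R) (m2 : probability T2 R) (f : T1 * T2 -> R[i]) :
  bounded_mfun f ->
  cintegral (m1 \x m2)%E f =
  cintegral m2 (fun y => cintegral m1 (fun x => f (x, y))).
Proof.
move=> bf.
have [ir ii] : cintegrable (m1 \x m2)%E f.
  exact/bounded_mfun_cintegrable/bf/product_measure1_lty.
have sec y : cintegrable m1 (fun x => f (x, y)).
  apply: bounded_mfun_cintegrable; first exact: probability_lty.
  exact: (bounded_mfun_comp (pair2_measurable y) bf).
have E (g : T1 * T2 -> R) : (m1 \x m2)%E.-integrable setT (EFin \o g) ->
    (forall y, m1.-integrable setT (EFin \o (fun x => g (x, y)))) ->
    \int[(m1 \x m2)%E]_z g z = \int[m2]_y \int[m1]_x g (x, y).
  move=> ig gs; congr fine; rewrite -(integral21_prod_meas1 ig).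
  (* Each section has a finite integral, so nothing is lost when [fine] is applied inside the outer
     integral. *)
  apply: eq_integral => y _; rewrite /fubini_G /Rintegral fineK //.
  exact: (integrable_fin_num _ (gs y)).
rewrite /cintegral !E //= => y; by have [] := sec y.
Qed.

(** * The Borel structure of the unitary group *)

Section UnitaryBorel.
Context {R : realType} {d : nat}.
Local Notation C := R[i].
Local Notation unitary := (unitary R d).
Implicit Types U W : unitary.

(** The measurable sets of the unitary group are generated by its open sets, and the Borel sets of
    the line by open intervals. *)
Lemma continuous_measurable_unitary (g : unitary -> R) :
  continuous g -> measurable_fun setT g.
Proof.
move=> /continuousP cg; apply: (measurability _ (RGenOpens.measurableE R)).
move=> _ [_ [a [b ->]] <-]; rewrite setTI; apply: sub_sigma_algebra.
exact/cg/interval_open.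
Qed.

Lemma continuous_unitary_val : continuous (@unitary_val R d).
Proof. exact: initial_continuous. Qed.

Lemma continuous_unitary_entry i j : continuous (fun U => U i j : C).
Proof.
move=> U; apply: (@continuous_comp _ _ _ (@unitary_val R d)
  (fun M : 'M[C]_d => M i j)).
  exact: continuous_unitary_val.
move=> s /= /(nbhs_ballP (unitary_val U i j)) [e e0 es].
by apply/nbhs_ballP; exists e => //= N [_ MN]; exact/es/MN.
Qed.

Lemma normc_Re_le (z : C) : `|complex.Re z|%:C <= `|z|.
Proof.
rewrite normc_def lecR -sqrtr_sqr ler_wsqrtr // lerDl sqr_ge0 //.
Qed.

Lemma normc_Im_le (z : C) : `|complex.Im z|%:C <= `|z|.
Proof.
rewrite normc_def lecR -sqrtr_sqr ler_wsqrtr // lerDr sqr_ge0 //.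
Qed.

Lemma continuous_Re : continuous (fun z : C => complex.Re z).
Proof.
move=> z s /= /(nbhs_ballP (complex.Re z)) [e e0 es].
apply/nbhs_ballP; exists e%:C; first by rewrite /= ltcR.
move=> w zw; apply: es; rewrite /ball /= -ltcR.
apply: le_lt_trans zw; apply: le_trans (normc_Re_le _).
by case: z w => [? ?] [? ?].
Qed.

Lemma continuous_Im : continuous (fun z : C => complex.Im z).
Proof.
move=> z s /= /(nbhs_ballP (complex.Im z)) [e e0 es].
apply/nbhs_ballP; exists e%:C; first by rewrite /= ltcR.
move=> w zw; apply: es; rewrite /ball /= -ltcR.
apply: le_lt_trans zw; apply: le_trans (normc_Im_le _).
by case: z w => [? ?] [? ?].
Qed.

(** The diagonal entry (i, i) of U U^* = 1 is a sum of squared moduli, one of which is |U_ij|^2. *)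
Lemma unitary_entry_norm (U : 'M[C]_d) i j : U \is unitarymx -> `|U i j| <= 1.
Proof.
move=> /unitarymxP /matrixP /(_ i i); rewrite !mxE eqxx mulr1n => UU.
rewrite -(@expr_le1 _ 2) // -UU (bigD1 j) //= !mxE -normCK lerDl.
by apply: sumr_ge0 => k _; rewrite !mxE -normCK exprn_ge0.
Qed.

Lemma bounded_mfun_entry i j : bounded_mfun (fun U => U i j : C).
Proof.
split.
- apply: continuous_measurable_unitary => U.
  apply: (@continuous_comp _ _ _ (fun U : unitary => U i j : C)).
    exact: continuous_unitary_entry.
  exact: continuous_Re.
- apply: continuous_measurable_unitary => U.
  apply: (@continuous_comp _ _ _ (fun U : unitary => U i j : C)).
    exact: continuous_unitary_entry.
  exact: continuous_Im.
exists 1 => U; have U1 := unitary_entry_norm i j (unitary_valP U).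
by split; rewrite -lecR; [apply: le_trans (normc_Re_le _) _
                         |apply: le_trans (normc_Im_le _) _].
Qed.

Lemma unitary_mul_val W U :
  unitary_val (unitary_mul W U) = unitary_val W *m unitary_val U.
Proof. by []. Qed.

Lemma continuous_unitary_mulmx (W : 'M[C]_d) : W \is unitarymx ->
  continuous (fun M : 'M[C]_d => W *m M).
Proof.
move=> WU M s /= /(nbhs_ballP (W *m M)) [e e0 es].
have d0 : 0 < d.+1%:R :> C by rewrite ltr0n.
(* An entry of W (M - N) is a sum of d terms of modulus at most [e / d.+1%:R]. Dividing by d + 1
   instead of d makes the total strictly less than [e] and keeps the radius positive when d = 0. *)
apply/nbhs_ballP; exists (e / d.+1%:R); first by rewrite /= divr_gt0.
move=> N [_ MN]; apply: es; split=> // i j; rewrite !mxE /ball /= -sumrB.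
apply: le_lt_trans (ler_norm_sum _ _ _) _.
apply: (@le_lt_trans _ _ (\sum_(k < d) e / d.+1%:R)).
  apply: ler_sum => k _; rewrite -mulrBr normrM -[leRHS]mul1r.
  by apply: ler_pM => //; [exact: unitary_entry_norm|exact/ltW/MN].
rewrite sumr_const card_ord -mulrnAl -mulr_natr ltr_pdivrMr // ltr_pM2l //.
by rewrite ltr_nat.
Qed.

Lemma continuous_unitary_mul W : continuous (unitary_mul W).
Proof.
apply: continuous_comp_initial => U.
apply: (@continuous_comp _ _ _ (@unitary_val R d)
  (fun M => unitary_val W *m M)).
  exact: continuous_unitary_val.
exact/continuous_unitary_mulmx/unitary_valP.
Qed.

Lemma measurable_unitary_mul W : measurable_fun setT (unitary_mul W).
Proof.
apply: (@measurability _ _ unitary unitary setT _ (@open unitary)) => //.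
move=> _ [A oA <-]; rewrite setTI; apply: sub_sigma_algebra.
by have /continuousP := @continuous_unitary_mul W; apply.
Qed.

Lemma unitary_val_inj : injective (@unitary_val R d).
Proof. exact: val_inj. Qed.

Lemma unitary_adjoint U : (unitary_val U)^t* \is unitarymx.
Proof. by rewrite trmxC_unitary unitary_valP. Qed.

(** [haar_measure] speaks of direct images. The preimage of a set under left multiplication by W is
    its image under left multiplication by the adjoint of W, so [mu] is its own pushforward. *)
Lemma cintegral_haar (mu : probability unitary R) W (f : unitary -> C) :
  haar_measure mu -> bounded_mfun f ->
  cintegral mu f = cintegral mu (fun U => f (unitary_mul W U)).
Proof.
move=> haar bf; apply: cintegral_pushforward => //.
- exact: probability_lty.
- exact: measurable_unitary_mul.
move=> A mA; pose W' := mk_unitary (unitary_adjoint W).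
have WK : cancel (unitary_mul W') (unitary_mul W).
  move=> U; apply: unitary_val_inj; rewrite !unitary_mul_val /= mulmxA.
  by have /unitarymxP -> := unitary_valP W; rewrite mul1mx.
have W'K : cancel (unitary_mul W) (unitary_mul W').
  move=> U; apply: unitary_val_inj; rewrite !unitary_mul_val /= mulmxA.
  have /unitarymxP := unitary_adjoint W; rewrite trmxCK => ->.
  by rewrite mul1mx.
apply: (etrans (esym (haar W' A mA))); congr (mu _).
apply/seteqP; split => [U /= [V AV <-]|U /= AU]; first by rewrite WK.
by exists (unitary_mul W U) => //; rewrite W'K.
Qed.

End UnitaryBorel.

(** * Fourth-order moments of the Haar measure *)

Section UnitaryMoments.
Context {R : realType} {d : nat}.
Local Notation C := R[i].
Local Notation unitary := (unitary R d).
Implicit Types U W : unitary.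
Variables (mu : probability unitary R) (mu_haar : haar_measure mu).
Variables (j k : 'I_d).

(** The (a, b) entry of the projection onto the line of U e_j times the (c, e) entry of the
    projection onto the line of U e_k. *)
Let word (a b c e : 'I_d) (U : unitary) : C :=
  U a j * (U b j)^*%R * (U c k * (U e k)^*%R).

Definition unitary_moment (a b c e : 'I_d) : C := cintegral mu (word a b c e).
Local Notation mom := unitary_moment.

Let bounded_word a b c e : bounded_mfun (word a b c e).
Proof.
by apply: bounded_mfunM; apply: bounded_mfunM;
  do ?apply: bounded_mfun_conj; exact: bounded_mfun_entry.
Qed.

Let integrable_word a b c e : cintegrable mu (word a b c e).
Proof.
by apply: bounded_mfun_cintegrable; [exact: probability_lty|exact: bounded_word].
Qed.

Lemma unitary_moment_translate W a b c e :
  mom a b c e = cintegral mu (fun U => word a b c e (unitary_mul W U)).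
Proof. by apply: cintegral_haar => //; exact: bounded_word. Qed.

(** Left translation by the diagonal matrix of [w] multiplies row m of U by the phase [w m]. *)
Lemma unitary_moment_diag (w : 'I_d -> C) a b c e :
  (forall m, w m * (w m)^*%R = 1) ->
  mom a b c e = (w a * (w b)^*%R * (w c * (w e)^*%R)) * mom a b c e.
Proof.
move=> ww; pose D : 'M[C]_d := diag_mx (\row_m w m).
have DU : D \is unitarymx.
  apply/unitarymxP/matrixP => x y; rewrite mul_diag_mx !mxE eq_sym.
  by case: eqP => [->|_]; rewrite ?mulr1n ?mulr0n ?rmorph0 ?mulr0 // ww.
rewrite {1}(unitary_moment_translate (mk_unitary DU)).
rewrite -cintegralZ //; congr cintegral; apply/funext => U.
by rewrite /word !unitary_mul_val /= !mul_diag_mx !mxE !rmorphM /=; ring.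
Qed.

(** Left translation by a permutation matrix relabels the four rows simultaneously. *)
Lemma unitary_moment_perm (s : {perm 'I_d}) a b c e :
  mom a b c e = mom (s a) (s b) (s c) (s e).
Proof.
have sU : (perm_mx s : 'M[C]_d) \is unitarymx.
  apply/unitarymxP; rewrite tr_perm_mx map_perm_mx -perm_mxM mulgV.
  exact: perm_mx1.
rewrite (unitary_moment_translate (mk_unitary sU)).
congr cintegral; apply/funext => U.
by rewrite /word !unitary_mul_val /= -row_permE !mxE.
Qed.

(** With the phase i on a single row p and 1 elsewhere, the moment is multiplied by a power of i
    whose exponent counts p in {a, c} minus p in {b, e}. If the rows do not pair up, some p gives a
    factor other than 1. The phase -1 would miss the case a = c, b = e with a different from b. *)
Lemma unitary_moment_eq0 a b c e :
  ~~ ((a == b) && (c == e) || (a == e) && (c == b)) -> mom a b c e = 0.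
Proof.
move=> abce.
pose w (p m : 'I_d) : C := if m == p then 'i%C else 1.
have ii : 'i%C * ('i%C)^*%R = 1 :> C.
  have -> : ('i%C)^*%R = - 'i%C :> C.
    by apply/eqP; rewrite eq_complex /= oppr0 !eqxx.
  by rewrite mulrN -expr2 sqr_i opprK.
have ww p m : w p m * (w p m)^*%R = 1.
  by rewrite /w; case: ifP => _ //; rewrite rmorph1 mulr1.
have E p : w p a * (w p b)^*%R * (w p c * (w p e)^*%R) != 1 -> mom a b c e = 0.
  move=> w1; apply/eqP; move: (unitary_moment_diag a b c e (ww p)) => /esym /eqP.
  by rewrite -subr_eq0 -{2}[mom _ _ _ _]mul1r -mulrBl mulf_eq0 subr_eq0 (negbTE w1).
have i1 : 'i%C != 1 :> C by rewrite eq_complex /= oner_eq0 andbF.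
have iN1 : 'i%C * 'i%C != 1 :> C.
  rewrite -expr2 sqr_i -subr_eq0 -opprD oppr_eq0.
  by rewrite (_ : 1 + 1 = 2%:R) ?pnatr_eq0 // -natrD.
have conji1 : ('i%C)^*%R != 1 :> C.
  by rewrite -(inj_eq (inv_inj (@conjCK _))) conjCK rmorph1.
(* The test row is a when a differs from both b and e, with factor i or i^2 according to c.
   Otherwise it is c, and the factor is i. *)
have [ab|ab] := eqVneq a b; last first.
  have [ae|ae] := eqVneq a e; last first.
    apply: (E a); rewrite /w eqxx (eq_sym b) (eq_sym e) (negbTE ab) (negbTE ae).
    by rewrite rmorph1 !mulr1; case: ifP => _; rewrite ?mulr1.
  apply: (E c); rewrite /w eqxx -ae (eq_sym b).
  move: abce; rewrite (negbTE ab) ae eqxx /= => /negbTE ->.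
  by case: ifP => _; rewrite ?rmorph1 ?mulr1 ?mul1r // ii mulr1.
apply: (E c); rewrite /w eqxx -ab (eq_sym e).
move: abce; rewrite ab eqxx /= negb_or => /andP[/negbTE -> _].
by case: ifP => _; rewrite ?rmorph1 ?mulr1 ?mul1r // ii mul1r.
Qed.

(* The Householder reflection of [e_p - 2 e_q] has the rational row
   [3/5 e_p + 4/5 e_q]. *)
Lemma unitary_moment_rotation (p q : 'I_d) : p != q ->
  mom p p p p = mom p p q q + mom p q q p.
Proof.
move=> pq; have pqF := negbTE pq.
have qpF : (q == p) = false by rewrite eq_sym.
have [v vE] : exists v : 'cV[C]_d,
    forall a, v a 0 = (a == p)%:R - 2 * (a == q)%:R.
  by exists (delta_mx p 0 - 2 *: delta_mx q 0) => a; rewrite !mxE !andbT.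
have vconj a : (v a 0)^*%R = v a 0.
  by rewrite vE rmorphB rmorphM /= !rmorph_nat.
have sumv (F : 'I_d -> C) : \sum_a v a 0 * F a = F p - 2 * F q.
  rewrite (bigD1 p) //= (bigD1 q) 1?eq_sym //= big1 => [|a /andP[ap aq]].
    by rewrite !vE !eqxx pqF qpF /=; ring.
  by rewrite vE (negbTE ap) (negbTE aq) /=; ring.
(* The coefficient is 2 / (v^T v), so [H] negates [v] and fixes its orthogonal complement. *)
pose H : 'M[C]_d := 1%:M - (2 / 5) *: (v *m v^T).
have HT : H^t* = H.
  apply/matrixP => a b; rewrite !mxE !big_ord1 !mxE rmorphB !rmorphM /=.
  rewrite fmorphV !rmorph_nat !vconj eq_sym; congr (_ - _ * _).
  exact: mulrC.
have vv : v^T *m v = 5%:M.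
  apply/matrixP => x y; rewrite !ord1 !mxE eqxx mulr1n.
  under eq_bigr do rewrite [v^T _ _]mxE.
  by rewrite sumv !vE !eqxx pqF qpF /=; ring.
have HU : H \is unitarymx.
  apply/unitarymxP; rewrite HT /H mulmxBl mul1mx mulmxBr mulmx1.
  rewrite -scalemxAl -scalemxAr mulmxA -(mulmxA v) vv mul_mx_scalar -scalemxAl.
  rewrite !scalerA.
  rewrite (_ : 2 / 5 * (2 / 5 * 5) = 2 / 5 + 2 / 5); last by field.
  by rewrite scalerDl; set X := _ *: _; rewrite opprB addrK subrK.
pose pt (x : bool) := if x then p else q.
pose co (x : bool) : C := if x then 3 / 5 else 4 / 5.
have Hrow U l : unitary_val (unitary_mul (mk_unitary HU) U) p l =
    \sum_x co x * U (pt x) l.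
  have vU : (v^T *m unitary_val U) 0 l = U p l - 2 * U q l.
    rewrite mxE -(sumv (fun a => U a l)).
    by apply: eq_bigr => a _; rewrite mxE.
  rewrite unitary_mul_val /= /H mulmxBl mul1mx -scalemxAl -mulmxA mxE.
  rewrite [X in _ + X]mxE [X in _ - X]mxE [X in _ - _ * X]mxE big_ord1 vU vE.
  by rewrite big_bool /= eqxx pqF /=; field.
(* Row p of H U is 3/5 of row p plus 4/5 of row q of U; expanding the four factors gives sixteen
   moments. *)
have E : mom p p p p = \sum_x \sum_y \sum_z \sum_t
    (co x * co y * co z * co t) * mom (pt x) (pt y) (pt z) (pt t).
  rewrite (unitary_moment_translate (mk_unitary HU)).
  transitivity (cintegral mu (fun U => \sum_x \sum_y \sum_z \sum_t
    (co x * co y * co z * co t) * word (pt x) (pt y) (pt z) (pt t) U)).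
    congr cintegral; apply/funext => U; rewrite /word !Hrow !big_bool /=.
    by rewrite !rmorphD !rmorphM /= !fmorphV !rmorph_nat; field.
  rewrite cintegral_sum => [|x].
    apply: eq_bigr => x _; rewrite cintegral_sum => [|y].
      apply: eq_bigr => y _; rewrite cintegral_sum => [|z].
        apply: eq_bigr => z _; rewrite cintegral_sum => [|t].
          by apply: eq_bigr => t _; rewrite cintegralZ.
        exact: cintegrableZ.
      by apply: cintegrable_sum => t; exact: cintegrableZ.
    by do 2!apply: cintegrable_sum => ?; exact: cintegrableZ.
  by do 3!apply: cintegrable_sum => ?; exact: cintegrableZ.
have Eqqqq : mom q q q q = mom p p p p.
  by rewrite (unitary_moment_perm (tperm p q)) !tpermR.
have Eqqpp : mom q q p p = mom p p q q.
  by rewrite (unitary_moment_perm (tperm p q)) !tpermR !tpermL.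
have Eqppq : mom q p p q = mom p q q p.
  by rewrite (unitary_moment_perm (tperm p q)) !tpermR !tpermL.
move: E; rewrite !big_bool /= Eqqqq Eqqpp Eqppq.
have zero a b c e : ~~ ((a == b) && (c == e) || (a == e) && (c == b)) ->
  mom a b c e = 0 by exact: unitary_moment_eq0.
rewrite (zero p p p q) ?(zero p p q p) ?(zero p q p p) ?(zero q p p p)
  ?(zero q q q p) ?(zero q q p q) ?(zero q p q q) ?(zero p q q q)
  ?(zero p q p q) ?(zero q p q p) ?eqxx ?qpF ?pqF //.
set S := mom p p p p; set P := mom p p q q; set Q := mom p q q p => E.
(* Six moments survive, identified two by two by the transposition of p and q. [E] then reads S =
   (3^4 + 4^4)/5^4 S + 2 (3^2 4^2)/5^4 (P + Q), and 625 - 81 - 256 = 2 * 144 = 288. *)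
have : 288 * (S - (P + Q)) = 0.
  apply: (@mulfI _ 625^-1); first by rewrite invr_eq0 pnatr_eq0.
  by rewrite mulr0 -[RHS](subrr S) {3}E; field.
by move=> /eqP; rewrite mulf_eq0 pnatr_eq0 /= subr_eq0 => /eqP.
Qed.

End UnitaryMoments.

(** * The second-order Weingarten formula *)

Section WeingartenFormula.
Context {R : realType} {d : nat}.
Local Notation C := R[i].
Local Notation unitary := (unitary R d).
Variables (mu : probability unitary R) (mu_haar : haar_measure mu).
Hypothesis d_gt1 : (1 < d)%N.
Implicit Types (j k a b c e : 'I_d).

Let delta (x y : 'I_d) : C := (x == y)%:R.

Let integrable_word j k a b c e : cintegrable mu
  (fun U : unitary => U a j * (U b j)^*%R * (U c k * (U e k)^*%R)).
Proof.
apply: bounded_mfun_cintegrable; first exact: probability_lty.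
by apply: bounded_mfunM; apply: bounded_mfunM;
  do ?apply: bounded_mfun_conj; exact: bounded_mfun_entry.
Qed.

(** [unitarymxP] expresses orthonormality of the rows; applied to the adjoint it yields that of the
    columns. *)
Lemma unitary_col_dot (U : 'M[C]_d) j k : U \is unitarymx ->
  \sum_a U a j * (U a k)^*%R = delta j k.
Proof.
rewrite -trmxC_unitary => /unitarymxP; rewrite trmxCK => /matrixP /(_ k j).
rewrite !mxE /delta eq_sym => <-.
by apply: eq_bigr => a _; rewrite !mxE mulrC.
Qed.

(** P and Q are the moments with the two pairings on a fixed pair of distinct rows. Permutations
    carry them to every such pair, the rotation identity gives P + Q when all four rows agree, and
    the remaining moments vanish. *)
Lemma unitary_moment_shape j k : exists P Q : C, forall a b c e,
  unitary_moment mu j k a b c e =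
  P * (delta a b * delta c e) + Q * (delta a e * delta c b).
Proof.
pose p0 : 'I_d := Ordinal (ltnW d_gt1); pose q0 : 'I_d := Ordinal d_gt1.
have pq0 : p0 != q0 by [].
(* One transposition sends [p0] to a; a second one sends the image of [q0] to b and leaves a in
   place. *)
have move_pair a b : a != b -> exists s : {perm 'I_d}, s p0 = a /\ s q0 = b.
  move=> ab; pose s1 := tperm p0 a; exists (s1 * tperm (s1 q0) b)%g.
  rewrite !permM (tpermL p0); split; last by rewrite tpermL.
  rewrite tpermD // 1?eq_sym //.
  by rewrite -[X in X != _](tpermL p0 a) (inj_eq perm_inj).
exists (unitary_moment mu j k p0 p0 q0 q0), (unitary_moment mu j k p0 q0 q0 p0).
have PE a b : a != b ->
    unitary_moment mu j k a a b b = unitary_moment mu j k p0 p0 q0 q0.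
  by move=> /move_pair[s [<- <-]]; rewrite -unitary_moment_perm.
have QE a b : a != b ->
    unitary_moment mu j k a b b a = unitary_moment mu j k p0 q0 q0 p0.
  by move=> /move_pair[s [<- <-]]; rewrite -unitary_moment_perm.
have simp := (mulr1n, mulr0n, mul0r, mulr0, mul1r, mulr1, add0r, addr0).
move=> a b c e; rewrite /delta.
have [<-|ab] := eqVneq a b.
  have [<-|ce] := eqVneq c e.
    have [<-|ac] := eqVneq a c; last by rewrite PE //= !simp.
    have [q aq] : exists q, a != q.
      by have [->|] := eqVneq a p0; [exists q0|exists p0].
    by rewrite (unitary_moment_rotation mu_haar _ _ aq) PE // QE //= !simp.
  rewrite unitary_moment_eq0 //; last first.
    rewrite (negbTE ce) eqxx /=; apply: contra ce => /andP[/eqP <- /eqP ->].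
    by [].
  rewrite /= !simp; have [ae|] := eqVneq a e; last by rewrite !simp.
  by rewrite -ae in ce *; rewrite (negbTE ce) /= !simp.
rewrite /= !simp.
have [<-|ae] := eqVneq a e; have [->|cb] := eqVneq c b; rewrite /= !simp.
- by rewrite QE.
- by rewrite unitary_moment_eq0 // (negbTE ab) (negbTE cb) andbF.
- by rewrite unitary_moment_eq0 // (negbTE ab) (negbTE ae).
- by rewrite unitary_moment_eq0 // (negbTE ab) (negbTE ae).
Qed.

(** These are Wg(1) + delta_jk Wg(swap) and delta_jk Wg(1) + Wg(swap), where Wg(1) = 1/(d^2 - 1) and
    Wg(swap) = -1/(d (d^2 - 1)) are the values of the Weingarten function of order two. *)
Definition weingarten_id j k : C :=
  (d%:R - delta j k) / (d%:R * (d%:R ^+ 2 - 1)).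
Definition weingarten_swap j k : C :=
  (d%:R * delta j k - 1) / (d%:R * (d%:R ^+ 2 - 1)).

(** This and [unitary_moment_swap] are the two equations for the unknown coefficients. Here the
    integrand sums to the product of the squared norms of columns j and k, there to the squared
    modulus of their inner product. *)
Lemma unitary_moment_trace j k :
  \sum_a \sum_c unitary_moment mu j k a a c c = 1.
Proof.
have cint a : cintegrable mu
    (fun U : unitary => \sum_c U a j * (U a j)^*%R * (U c k * (U c k)^*%R)).
  by apply: cintegrable_sum => c; exact: integrable_word.
transitivity (cintegral mu (fun _ : unitary => 1 : C)); last exact: cintegral_cst.
under eq_bigr do rewrite -cintegral_sum //.
rewrite -cintegral_sum //; congr cintegral; apply/funext => U.
under eq_bigr do rewrite -mulr_sumr.
by rewrite -mulr_suml !unitary_col_dot ?unitary_valP // /delta !eqxx mulr1.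
Qed.

Lemma unitary_moment_swap j k :
  \sum_a \sum_c unitary_moment mu j k a c c a = delta j k.
Proof.
have cint a : cintegrable mu
    (fun U : unitary => \sum_c U a j * (U c j)^*%R * (U c k * (U a k)^*%R)).
  by apply: cintegrable_sum => c; exact: integrable_word.
transitivity (cintegral mu (fun _ : unitary => delta j k));
  last exact: cintegral_cst.
under eq_bigr do rewrite -cintegral_sum //.
rewrite -cintegral_sum //; congr cintegral; apply/funext => U.
transitivity (\sum_(a < d) unitary_val U a j * (unitary_val U a k)^*%R *
    \sum_(c < d) unitary_val U c k * (unitary_val U c j)^*%R).
  apply: eq_bigr => a _; rewrite mulr_sumr.
  by apply: eq_bigr => c _; ring.
rewrite -mulr_suml !unitary_col_dot ?unitary_valP // /delta (eq_sym k).
by case: eqP; rewrite ?mulr1 ?mulr0.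
Qed.

Lemma sum_eq_mull (F : 'I_d -> C) a : \sum_b (a == b)%:R * F b = F a.
Proof.
rewrite (bigD1 a) //= eqxx mul1r big1 ?addr0 // => b ba.
by rewrite eq_sym (negbTE ba) mul0r.
Qed.

(** The two contractions of the shape with unknown P and Q form the linear system [E1], [E2], whose
    determinant d^2 (d^2 - 1) is nonzero because d > 1. *)
Lemma weingarten j k a b c e :
  unitary_moment mu j k a b c e =
  weingarten_id j k * (delta a b * delta c e) +
  weingarten_swap j k * (delta a e * delta c b).
Proof.
have [P [Q PQ]] := unitary_moment_shape j k; rewrite PQ.
have d0 : d%:R != 0 :> C by rewrite pnatr_eq0 -lt0n ltnW.
have d2 : d%:R ^+ 2 - 1 != 0 :> C.
  rewrite subr_eq0 -natrX -[1]/(1%:R) eqr_nat.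
  by rewrite -[X in _ != X](exp1n 2) eqn_exp2r // gtn_eqF.
have dd a' : delta a' a' = 1 by rewrite /delta eqxx.
have sum1 : \sum_(x < d) (1 : C) = d%:R by rewrite sumr_const card_ord.
have dC x y : delta x y = delta y x by rewrite /delta eq_sym.
have E1 : P * d%:R ^+ 2 + Q * d%:R = 1.
  apply: (etrans _ (unitary_moment_trace j k)); apply/esym.
  transitivity (\sum_(x < d) \sum_(y < d)
    (P * (1 * 1) + Q * (delta x y * delta x y))).
    by apply: eq_bigr => x _; apply: eq_bigr => y _; rewrite PQ !dd (dC y).
  transitivity (\sum_(x < d) (P * d%:R + Q) * 1).
    apply: eq_bigr => x _; rewrite big_split /= -!mulr_sumr sum_eq_mull dd.
    by rewrite mul1r sum1 !mulr1.
  by rewrite -mulr_sumr sum1; ring.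
have E2 : P * d%:R + Q * d%:R ^+ 2 = delta j k.
  apply: (etrans _ (unitary_moment_swap j k)); apply/esym.
  transitivity (\sum_(x < d) \sum_(y < d)
    (P * (delta x y * delta x y) + Q * (1 * 1))).
    by apply: eq_bigr => x _; apply: eq_bigr => y _; rewrite PQ !dd (dC y).
  transitivity (\sum_(x < d) (P + Q * d%:R) * 1).
    apply: eq_bigr => x _; rewrite big_split /= -!mulr_sumr sum_eq_mull dd.
    by rewrite mul1r sum1 !mulr1.
  by rewrite -mulr_sumr sum1; ring.
have D0 : d%:R * (d%:R ^+ 2 - 1) != 0 :> C by rewrite mulf_neq0.
(* d times [E1] minus [E2] eliminates Q; exchanging the roles of the two equations eliminates P. *)
have -> : P = weingarten_id j k.
  apply: (canRL (mulfK D0)).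
  transitivity (d%:R * (P * d%:R ^+ 2 + Q * d%:R) - (P * d%:R + Q * d%:R ^+ 2)).
    by ring.
  by rewrite E1 E2 mulr1.
suff -> : Q = weingarten_swap j k by [].
apply: (canRL (mulfK D0)).
transitivity (d%:R * (P * d%:R + Q * d%:R ^+ 2) - (P * d%:R ^+ 2 + Q * d%:R)).
  by ring.
by rewrite E1 E2.
Qed.

End WeingartenFormula.

(** * Integrals of matrix-valued functions *)

Section MatrixIntegral.
Context {R : realType} {disp : measure_display} {T : measurableType disp}.
Local Notation C := R[i].

Definition mx_bounded m n (F : T -> 'M[C]_(m, n)) : Prop :=
  forall i j, bounded_mfun (fun x => F x i j).

Lemma mx_bounded_cst m n (A : 'M[C]_(m, n)) : mx_bounded (fun=> A).
Proof. by move=> i j; exact: bounded_mfun_cst. Qed.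

Lemma mx_boundedD m n (F G : T -> 'M[C]_(m, n)) :
  mx_bounded F -> mx_bounded G -> mx_bounded (fun x => F x + G x).
Proof.
move=> bF bG i j; rewrite (_ : (fun _ => _) = fun x => F x i j + G x i j).
  exact: bounded_mfunD.
by apply/funext => x; rewrite mxE.
Qed.

Lemma mx_boundedZ m n (f : T -> C) (F : T -> 'M[C]_(m, n)) :
  bounded_mfun f -> mx_bounded F -> mx_bounded (fun x => f x *: F x).
Proof.
move=> bf bF i j; rewrite (_ : (fun _ => _) = fun x => f x * F x i j).
  exact: bounded_mfunM.
by apply/funext => x; rewrite mxE.
Qed.

Lemma mx_boundedM m n p (F : T -> 'M[C]_(m, n)) (G : T -> 'M[C]_(n, p)) :
  mx_bounded F -> mx_bounded G -> mx_bounded (fun x => F x *m G x).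
Proof.
move=> bF bG i j; rewrite (_ : (fun _ => _) = fun x => \sum_k F x i k * G x k j).
  by apply: bounded_mfun_sum => k; exact: bounded_mfunM.
by apply/funext => x; rewrite mxE.
Qed.

Lemma mx_bounded_sum (I : finType) m n (F : I -> T -> 'M[C]_(m, n)) :
  (forall k, mx_bounded (F k)) -> mx_bounded (fun x => \sum_k F k x).
Proof.
move=> bF i j; rewrite (_ : (fun _ => _) = fun x => \sum_k F k x i j).
  by apply: bounded_mfun_sum => k; exact: bF.
by apply/funext => x; rewrite summxE.
Qed.

Lemma bounded_mfun_trace n (F : T -> 'M[C]_n) :
  mx_bounded F -> bounded_mfun (fun x => \tr (F x)).
Proof. by move=> bF; apply: bounded_mfun_sum => k; exact: bF. Qed.

(** Makes each entry of the image a fixed finite combination of entries of the argument, so that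
    boundedness and integration pass through a linear map. *)
Lemma linear_entryE m n p q (phi : {linear 'M[C]_(m, n) -> 'M[C]_(p, q)}) A i j :
  phi A i j = \sum_k \sum_l phi (delta_mx k l) i j * A k l.
Proof.
rewrite {1}(matrix_sum_delta A) linear_sum summxE; apply: eq_bigr => k _.
rewrite linear_sum summxE; apply: eq_bigr => l _.
by rewrite linearZ mxE mulrC.
Qed.

Lemma mx_bounded_linear m n p q (phi : {linear 'M[C]_(m, n) -> 'M[C]_(p, q)})
    (F : T -> 'M[C]_(m, n)) :
  mx_bounded F -> mx_bounded (fun x => phi (F x)).
Proof.
move=> bF i j; under eq_fun do rewrite linear_entryE.
do 2!apply: bounded_mfun_sum => ?.
by apply: bounded_mfunM; [exact: bounded_mfun_cst|exact: bF].
Qed.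

Section Integral.
Variables (mu : {measure set T -> \bar R}) (mu_lty : (mu setT < +oo)%E).

(** At a fixed X, [superop_integral mu F X] is [mxintegral mu (fun x => F x X)] by definition, so
    integrals of superoperators become integrals of matrices. *)
Definition mxintegral m n (F : T -> 'M[C]_(m, n)) : 'M[C]_(m, n) :=
  \matrix_(i, j) cintegral mu (fun x => F x i j).

Let cint f : bounded_mfun f -> cintegrable mu f.
Proof. exact: bounded_mfun_cintegrable. Qed.

Lemma mxintegralD m n (F G : T -> 'M[C]_(m, n)) :
  mx_bounded F -> mx_bounded G ->
  mxintegral (fun x => F x + G x) = mxintegral F + mxintegral G.
Proof.
move=> bF bG; apply/matrixP => i j; rewrite !mxE.
rewrite -cintegralD; [|exact/cint/bF|exact/cint/bG].
by congr cintegral; apply/funext => x; rewrite mxE.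
Qed.

Lemma mxintegral_sum (I : finType) m n (F : I -> T -> 'M[C]_(m, n)) :
  (forall k, mx_bounded (F k)) ->
  mxintegral (fun x => \sum_k F k x) = \sum_k mxintegral (F k).
Proof.
move=> bF; apply/matrixP => i j; rewrite summxE mxE.
under [RHS]eq_bigr do rewrite mxE.
rewrite -cintegral_sum => [|k]; last exact/cint/bF.
by congr cintegral; apply/funext => x; rewrite summxE.
Qed.

Lemma mxintegral_linear m n p q (phi : {linear 'M[C]_(m, n) -> 'M[C]_(p, q)})
    (F : T -> 'M[C]_(m, n)) :
  mx_bounded F -> mxintegral (fun x => phi (F x)) = phi (mxintegral F).
Proof.
move=> bF; apply/matrixP => i j; rewrite mxE linear_entryE.
under eq_fun do rewrite linear_entryE.
rewrite cintegral_sum => [|k].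
  apply: eq_bigr => k _; rewrite cintegral_sum => [|l].
    by apply: eq_bigr => l _; rewrite mxE cintegralZ //; exact/cint/bF.
  exact/cintegrableZ/cint/bF.
by apply: cintegrable_sum => l; exact/cintegrableZ/cint/bF.
Qed.

Lemma mxintegralZ m n c (F : T -> 'M[C]_(m, n)) :
  mx_bounded F -> mxintegral (fun x => c *: F x) = c *: mxintegral F.
Proof. exact: (mxintegral_linear ( *:%R c)). Qed.

Lemma cintegral_trace n (F : T -> 'M[C]_n) :
  mx_bounded F -> cintegral mu (fun x => \tr (F x)) = \tr (mxintegral F).
Proof.
move=> bF; rewrite /mxtrace cintegral_sum => [|i]; last exact/cint/bF.
by apply: eq_bigr => i _; rewrite mxE.
Qed.

Lemma mxintegral_scalel m n (f : T -> C) (A : 'M[C]_(m, n)) :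
  bounded_mfun f -> mxintegral (fun x => f x *: A) = cintegral mu f *: A.
Proof.
move=> bf; apply/matrixP => i j; rewrite !mxE mulrC -cintegralZ; last exact: cint.
by congr cintegral; apply/funext => x; rewrite mxE mulrC.
Qed.

End Integral.
End MatrixIntegral.

Lemma mxintegral_cst {R : realType} {disp : measure_display}
    {T : measurableType disp} (mu : probability T R) m n (A : 'M[R[i]]_(m, n)) :
  mxintegral mu (fun=> A) = A.
Proof. by apply/matrixP => i j; rewrite mxE cintegral_cst. Qed.

Lemma mxintegral_fubini {R : realType} {d1 d2 : measure_display}
    {T1 : measurableType d1} {T2 : measurableType d2}
    (m1 : probability T1 R) (m2 : probability T2 R) m n
    (F : T1 * T2 -> 'M[R[i]]_(m, n)) : mx_bounded F ->
  mxintegral (m1 \x m2)%E F =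
  mxintegral m2 (fun y => mxintegral m1 (fun x => F (x, y))).
Proof.
move=> bF; apply/matrixP => i j; rewrite mxE cintegral_fubini //.
by rewrite mxE; congr cintegral; apply/funext => y; rewrite mxE.
Qed.

(** * Twisted dephasing channels *)

Section TwistedDephasing.
Context {R : realType} {d : nat}.
Local Notation C := R[i].
Local Notation M := 'M[C]_d.
Implicit Types (U V X Y : M) (j k : 'I_d).

(** For unitary U this is the projection Q_j(U) onto the line of U e_j, given by entries so that its
    products match the integrands of [unitary_moment]. *)
Definition col_proj j U : M := \matrix_(a, b) (U a j * (U b j)^*%R).

Lemma col_proj_adj j U : (col_proj j U)^t* = col_proj j U.
Proof. by apply/matrixP => a b; rewrite !mxE rmorphM /= conjCK mulrC. Qed.

Lemma col_projE j U : col_proj j U = U *m delta_mx j j *m U^t*.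
Proof.
apply/matrixP => a b; rewrite !mxE (bigD1 j) //= big1 => [|m mj].
  rewrite !mxE (bigD1 j) //= big1 => [|l lj]; last first.
    by rewrite mxE (negbTE lj) mulr0.
  by rewrite mxE !eqxx mulr1 !addr0.
rewrite mxE big1 ?mul0r // => l _.
by rewrite mxE (negbTE mj) andbF mulr0.
Qed.

Lemma mxtrace_mul_delta X j k : \tr (X *m delta_mx j k) = X k j.
Proof.
rewrite mxtrace_mulC /mxtrace (bigD1 j) //= big1 => [|l lj].
  rewrite mxE (bigD1 k) //= big1 => [|m mk]; last first.
    by rewrite mxE (negbTE mk) andbF mul0r.
  by rewrite mxE !eqxx mul1r !addr0.
by rewrite mxE big1 // => m _; rewrite mxE (negbTE lj) mul0r.
Qed.

Lemma mxtrace_col_proj j U : U \is unitarymx -> \tr (col_proj j U) = 1.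
Proof.
move=> UU; rewrite /mxtrace; under eq_bigr do rewrite mxE.
by rewrite unitary_col_dot // eqxx.
Qed.

(** The k-th diagonal entry of V^* X V is tr(X Q_k(V)), and conjugating E_kk by U gives Q_k(U). *)
Lemma twisted_dephasingE (U V : unitary R d) X :
  twisted_dephasing U V X = \sum_k \tr (X *m col_proj k V) *: col_proj k U.
Proof.
rewrite /twisted_dephasing /= /dephasing linear_sum; apply: eq_bigr => k _.
rewrite linearZ /= /Ad trmxCK -col_projE; congr (_ *: _).
rewrite -[LHS](mxtrace_mul_delta _ k k) col_projE.
by rewrite -!mulmxA mxtrace_mulC !mulmxA.
Qed.

Lemma superop_traceE (phi : {linear M -> M}) :
  superop_trace phi = \sum_r \sum_s phi (delta_mx r s) r s.
Proof.
rewrite /superop_trace pair_big /= /mxtrace (reindex _ (curry_mxvec_bij _ _)) /=.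
by apply: eq_bigr => -[r s] _ /=; rewrite mxE /= vec_mx_delta mxvecE.
Qed.

(** The trace is the sum over r, s of the inner products of beta(E_rs) with tau(E_rs). The adjoint
    of beta(E_rs) is the sum of Q_j(V)_rs Q_j(U), and linearity of tau reassembles the coefficients
    Q_j(V)_rs into tau(Q_j(V)). *)
Lemma superop_inner_twisted (U V : unitary R d) (tau : {linear M -> M}) :
  superop_inner (twisted_dephasing U V) tau =
  \sum_j \tr (tau (col_proj j V) *m col_proj j U).
Proof.
transitivity (\sum_r \sum_s
    hs_inner (twisted_dephasing U V (delta_mx r s)) (tau (delta_mx r s))).
  (* The composite is packed as a linear map because [superop_traceE] is stated for linear maps. *)
  pose phi : M -> M := superop_adj (twisted_dephasing U V) \o tau.
  have phi_lin : linear phi.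
    move=> a X Y; apply/matrixP => r s; rewrite !mxE /hs_inner linearP.
    by rewrite mulmxDr -scalemxAr mxtraceD mxtraceZ.
  pose phiL := GRing.isLinear.Build _ _ _ _ phi phi_lin.
  pose phil : {linear M -> M} := HB.pack phi phiL.
  rewrite -[LHS]/(superop_trace phil) superop_traceE.
  by apply: eq_bigr => r _; apply: eq_bigr => s _; rewrite /= !mxE.
transitivity (\sum_r \sum_s \sum_j
    col_proj j V r s * \tr (tau (delta_mx r s) *m col_proj j U)).
  apply: eq_bigr => r _; apply: eq_bigr => s _.
  rewrite /hs_inner twisted_dephasingE; set T := tau _.
  have -> : (\sum_k \tr (delta_mx r s *m col_proj k V) *: col_proj k U)^t* =
      \sum_k col_proj k V r s *: col_proj k U.
    rewrite raddf_sum raddf_sum; apply: eq_bigr => k _ /=.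
    rewrite linearZ map_mxZ /= col_proj_adj mxtrace_mulC mxtrace_mul_delta.
    by rewrite -{2}(col_proj_adj k V) !mxE.
  rewrite mulmx_suml raddf_sum; apply: eq_bigr => k _ /=.
  by rewrite -scalemxAl mxtraceZ mxtrace_mulC.
under eq_bigr do rewrite exchange_big /=.
rewrite exchange_big /=; apply: eq_bigr => j _.
rewrite [in RHS](matrix_sum_delta (col_proj j V)) linear_sum mulmx_suml raddf_sum.
apply: eq_bigr => r _ /=; rewrite linear_sum mulmx_suml raddf_sum.
by apply: eq_bigr => s _ /=; rewrite linearZ -scalemxAl mxtraceZ.
Qed.

Lemma mxblock1_mul n (A : M) (v : 'M[C]_(\sum_(i < 1) d, n)) :
  (\mxblock_(i < 1, j < 1) A) *m v = \mxcol_(i < 1) (A *m submxcol v 0).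
Proof.
rewrite -{1}(submxcolK v) mul_mxblock_mxrow; apply: eq_mxcol => i /=.
by rewrite big_ord1.
Qed.

(** This is the ampliation with n = 1. A matrix has to be viewed as a single block, of dimension
    [\sum_(i < 1) d], and the quadratic forms are compared through this identification. *)
Lemma completely_positive_psd (phi : M -> M) (A : M) :
  completely_positive phi -> psd A -> psd (phi A).
Proof.
have quad (B : M) (v : 'cV[C]_(\sum_(i < 1) d)) :
    v^t* *m (\mxblock_(i < 1, j < 1) B) *m v =
    (submxcol v 0)^t* *m B *m submxcol v 0.
  have vE : v^t* = \mxrow_(i < 1) (submxcol v 0)^t*.
    rewrite -{1}(submxcolK v) tr_mxcol.
    transitivity (\mxrow_(i < 1) (submxcol v i)^t*).
      by apply/matrixP => x y; rewrite !mxE.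
    by apply: eq_mxrow => i; rewrite ord1.
  by rewrite -mulmxA mxblock1_mul vE mul_mxrow_mxcol big_ord1 mulmxA.
move=> cp Apsd v; have := cp 1%N (\mxblock_(i < 1, j < 1) A).
have pA : psd (\mxblock_(i < 1, j < 1) A) by move=> w; rewrite quad; exact: Apsd.
move=> /(_ pA) /(_ (\mxcol_(i < 1) v)).
rewrite /ampliation (_ : \mxblock_(i, j) _ = \mxblock_(i < 1, j < 1) phi A).
  by rewrite quad mxcolK.
by apply/eq_mxblockP => i j; rewrite mxblockK.
Qed.

Lemma psd_col_proj j U : psd (col_proj j U).
Proof.
move=> v; have -> : col_proj j U = col j U *m (col j U)^t*.
  by apply/matrixP => a b; rewrite !mxE big_ord1 !mxE.
have -> : v^t* *m (col j U *m (col j U)^t*) *m v =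
    ((col j U)^t* *m v)^t* *m ((col j U)^t* *m v).
  by rewrite trmx_mul map_mxM trmxCK !mulmxA.
rewrite mxE big_ord1 mxE mxE mulrC -normCK; exact: exprn_ge0.
Qed.

Lemma mxtrace_mul_col_proj j U X :
  \tr (X *m col_proj j U) = ((col j U)^t* *m X *m col j U) 0 0.
Proof.
have -> : col_proj j U = col j U *m (col j U)^t*.
  by apply/matrixP => a b; rewrite !mxE big_ord1 !mxE.
by rewrite mulmxA mxtrace_mulC mulmxA /mxtrace big_ord1.
Qed.

(** Each summand is the quadratic form of tau(Q_j(V)) at U e_j, which is nonnegative because Q_j(V)
    is positive semidefinite. *)
Lemma superop_inner_twisted_real (U V : unitary R d) (tau : {linear M -> M}) :
  completely_positive tau ->
  superop_inner (twisted_dephasing U V) tau \is Num.real.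
Proof.
move=> cp; rewrite superop_inner_twisted; apply: rpred_sum => j _.
rewrite mxtrace_mul_col_proj; apply: ger0_real.
exact/completely_positive_psd/psd_col_proj.
Qed.

End TwistedDephasing.

(** Serves the case d = 1, where the denominator of the Weingarten coefficients vanishes. The only 1
    x 1 matrix of trace 1 is the identity, so each Q_0 is the identity. *)
Lemma twisted_dephasing_dim1 {R : realType} (U V : unitary R 1)
    (X : 'M[R[i]]_1) :
  twisted_dephasing U V X = X.
Proof.
have col_proj1 (W : unitary R 1) : col_proj 0 W = 1%:M.
  rewrite [LHS]mx11_scalar; have := mxtrace_col_proj 0 (unitary_valP W).
  by rewrite /mxtrace big_ord1 => ->.
rewrite twisted_dephasingE big_ord1 !col_proj1 mulmx1 scalemx1 /mxtrace big_ord1.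
by rewrite -mx11_scalar.
Qed.

(** * Averages over a pair of Haar unitaries *)

Section TwistedDephasingMean.
Context {R : realType} {d : nat}.
Local Notation C := R[i].
Local Notation M := 'M[C]_d.
Variables (mu : probability (unitary R d) R) (mu_haar : haar_measure mu).
Implicit Types (j k : 'I_d) (A X : M).

Let mu_lty : (mu setT < +oo)%E. Proof. exact: probability_lty. Qed.

Lemma mx_bounded_col_proj j :
  mx_bounded (fun U : unitary R d => col_proj j U).
Proof.
move=> a b; rewrite (_ : (fun _ => _) =
  fun U : unitary R d => unitary_val U a j * (unitary_val U b j)^*%R).
  apply: bounded_mfunM; [|apply: bounded_mfun_conj]; exact: bounded_mfun_entry.
by apply/funext => U; rewrite mxE.
Qed.

Lemma mx_bounded_fst m n (F : unitary R d -> 'M[C]_(m, n)) :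
  mx_bounded F -> mx_bounded (fun p : unitary R d * unitary R d => F p.1).
Proof. by move=> bF i j; exact: (bounded_mfun_comp measurable_fst (bF i j)). Qed.

Lemma mx_bounded_snd m n (F : unitary R d -> 'M[C]_(m, n)) :
  mx_bounded F -> mx_bounded (fun p : unitary R d * unitary R d => F p.2).
Proof. by move=> bF i j; exact: (bounded_mfun_comp measurable_snd (bF i j)). Qed.

Lemma mx_bounded_trace_col_proj A j k :
  mx_bounded (fun U : unitary R d => \tr (A *m col_proj j U) *: col_proj k U).
Proof.
apply: mx_boundedZ; last exact: mx_bounded_col_proj.
by apply/bounded_mfun_trace/(mx_bounded_linear (mulmx A))/mx_bounded_col_proj.
Qed.

Lemma mx_bounded_twisted_dephasing X :
  mx_bounded (fun p : unitary R d * unitary R d => twisted_dephasing p.1 p.2 X).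
Proof.
under eq_fun do rewrite twisted_dephasingE.
apply: mx_bounded_sum => k; apply: mx_boundedZ; last first.
  exact: (mx_bounded_fst (mx_bounded_col_proj k)).
apply/bounded_mfun_trace/(mx_bounded_linear (mulmx X)).
exact: (mx_bounded_snd (mx_bounded_col_proj k)).
Qed.

Lemma bounded_mfun_trace_col_proj (tau : {linear M -> M}) j :
  bounded_mfun (fun p : unitary R d * unitary R d =>
    \tr (tau (col_proj j p.2) *m col_proj j p.1)).
Proof.
apply/bounded_mfun_trace/mx_boundedM; last first.
  exact: (mx_bounded_fst (mx_bounded_col_proj j)).
exact/mx_bounded_linear/(mx_bounded_snd (mx_bounded_col_proj j)).
Qed.

Lemma bounded_mfun_superop_inner (tau : {linear M -> M}) :
  bounded_mfun (fun p : unitary R d * unitary R d =>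
    superop_inner (twisted_dephasing p.1 p.2) tau).
Proof.
under eq_fun do rewrite superop_inner_twisted.
by apply: bounded_mfun_sum => j; exact: bounded_mfun_trace_col_proj.
Qed.

Hypothesis d_gt1 : (1 < d)%N.
Local Notation al := (@weingarten_id R d).
Local Notation be := (@weingarten_swap R d).

(** Contraction of [weingarten] with A: pairing rows within each projection yields tr(A) times the
    identity, the crossed pairing yields A itself. *)
Lemma mxintegral_col_proj2 A j k :
  mxintegral mu (fun U : unitary R d => \tr (A *m col_proj j U) *: col_proj k U) =
  (al j k * \tr A)%:M + be j k *: A.
Proof.
apply/matrixP => x y; rewrite mxE.
transitivity (cintegral mu (fun U : unitary R d => \sum_a \sum_b A a b *
  (unitary_val U b j * (unitary_val U a j)^*%R *
   (unitary_val U x k * (unitary_val U y k)^*%R)))).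
  congr cintegral; apply/funext => U; rewrite mxE mulr_suml; apply: eq_bigr => a _.
  rewrite mxE mulr_suml; apply: eq_bigr => b _; rewrite !mxE; ring.
have cint a b c e : cintegrable mu (fun U : unitary R d =>
    unitary_val U b j * (unitary_val U a j)^*%R *
   (unitary_val U c k * (unitary_val U e k)^*%R)).
  apply: bounded_mfun_cintegrable => //.
  by apply: bounded_mfunM; apply: bounded_mfunM;
    do ?apply: bounded_mfun_conj; exact: bounded_mfun_entry.
transitivity (\sum_a \sum_b A a b * unitary_moment mu j k b a x y).
  rewrite cintegral_sum => [|a].
    apply: eq_bigr => a _; rewrite cintegral_sum => [|b]; last exact: cintegrableZ.
    by apply: eq_bigr => b _; rewrite cintegralZ.
  by apply: cintegrable_sum => b; exact: cintegrableZ.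
transitivity (\sum_a \sum_b ((a == b)%:R * (A a b * al j k * (x == y)%:R) +
     (y == b)%:R * ((x == a)%:R * (A a b * be j k)))).
  apply: eq_bigr => a _; apply: eq_bigr => b _; rewrite weingarten //.
  by rewrite (eq_sym b) (eq_sym b); ring.
transitivity (\sum_a (A a a * (al j k * (x == y)%:R) +
    (x == a)%:R * (A a y * be j k))).
  apply: eq_bigr => a _; rewrite big_split /=.
  by rewrite !sum_eq_mull -mulrA.
rewrite big_split /= sum_eq_mull -mulr_suml !mxE /mxtrace.
rewrite -mulr_natr; ring.
Qed.

Let d_neq0 : d%:R != 0 :> C.
Proof. by rewrite pnatr_eq0 -lt0n ltnW. Qed.

Let d2_neq0 : d%:R ^+ 2 - 1 != 0 :> C.
Proof.
rewrite subr_eq0 -natrX -[1]/(1%:R) eqr_nat.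
by rewrite -[X in _ != X](exp1n 2) eqn_exp2r // gtn_eqF.
Qed.

Lemma weingarten_dim j k : al j k * d%:R + be j k = d%:R^-1.
Proof.
by rewrite /weingarten_id /weingarten_swap; field; rewrite d_neq0 d2_neq0.
Qed.

(** First moments are obtained from second ones: as tr Q_k(U) = 1, taking the trace in
    [mxintegral_col_proj2] with j = k removes one of the two projections. *)
Lemma cintegral_trace_col_proj A k :
  cintegral mu (fun U : unitary R d => \tr (A *m col_proj k U)) = d%:R^-1 * \tr A.
Proof.
have := congr1 mxtrace (mxintegral_col_proj2 A k k).
rewrite -cintegral_trace //; last exact: mx_bounded_trace_col_proj.
rewrite mxtraceD mxtrace_scalar mxtraceZ -[X in X + _]mulr_natr.
rewrite -(weingarten_dim k k) => E.
transitivity (al k k * \tr A * d%:R + be k k * \tr A); last by ring.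
rewrite -E; congr cintegral; apply/funext => U.
by rewrite mxtraceZ mxtrace_col_proj ?mulr1 // unitary_valP.
Qed.

Lemma mxintegral_col_proj k :
  mxintegral mu (fun U : unitary R d => col_proj k U) = (d%:R^-1)%:M.
Proof.
transitivity (mxintegral mu (fun U : unitary R d =>
    \tr (1%:M *m col_proj k U) *: col_proj k U)).
  congr mxintegral; apply/funext => U.
  by rewrite mul1mx mxtrace_col_proj ?scale1r // unitary_valP.
by rewrite mxintegral_col_proj2 mxtrace1 scalemx1 -raddfD weingarten_dim.
Qed.

(** Averaging over U replaces each Q_k(U) by 1/d; averaging over V then gives d equal terms
    tr(X)/d^2. *)
Lemma mxintegral_twisted_dephasing X :
  mxintegral (mu \x mu)%E
    (fun p : unitary R d * unitary R d => twisted_dephasing p.1 p.2 X) =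
  (\tr X / d%:R)%:M.
Proof.
rewrite mxintegral_fubini; last exact: mx_bounded_twisted_dephasing.
transitivity (mxintegral mu (fun V : unitary R d =>
    \sum_k \tr (X *m col_proj k V) *: (d%:R^-1)%:M : M)).
  congr mxintegral; apply/funext => V /=.
  under eq_fun do rewrite twisted_dephasingE.
  rewrite mxintegral_sum // => [|k]; last first.
    by apply: mx_boundedZ; [exact: bounded_mfun_cst|exact: mx_bounded_col_proj].
  apply: eq_bigr => k _; rewrite mxintegralZ ?mxintegral_col_proj //.
  exact: mx_bounded_col_proj.
have bX k : bounded_mfun (fun U : unitary R d => \tr (X *m col_proj k U)).
  by apply/bounded_mfun_trace/(mx_bounded_linear (mulmx X))/mx_bounded_col_proj.
rewrite mxintegral_sum // => [|k]; last first.
  by apply: mx_boundedZ => //; exact: mx_bounded_cst.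
transitivity (\sum_(k < d) (d%:R^-1 * \tr X) *: (d%:R^-1)%:M : M).
  by apply: eq_bigr => k _; rewrite mxintegral_scalel ?cintegral_trace_col_proj.
rewrite sumr_const card_ord scale_scalar_mx -scaler_nat scale_scalar_mx.
by congr (_%:M); field.
Qed.

Lemma mxintegral_superop_inner (tau : {linear M -> M}) X :
  trace_preserving tau -> unital tau ->
  mxintegral (mu \x mu)%E (fun p : unitary R d * unitary R d =>
    superop_inner (twisted_dephasing p.1 p.2) tau *: twisted_dephasing p.1 p.2 X) =
  \sum_j \sum_k ((al j k * (d%:R^-1 + be j k) * \tr X)%:M +
    be j k ^+ 2 *: tau X).
Proof.
move=> tau_tp tau1.
rewrite mxintegral_fubini; last first.
  by apply: mx_boundedZ; [exact: bounded_mfun_superop_inner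
                         |exact: mx_bounded_twisted_dephasing].
have bX k : bounded_mfun (fun U : unitary R d => \tr (X *m col_proj k U)).
  by apply/bounded_mfun_trace/(mx_bounded_linear (mulmx X))/mx_bounded_col_proj.
have bTXQ j k : mx_bounded (fun V : unitary R d =>
    tau (\tr (X *m col_proj k V) *: col_proj j V)).
  exact/mx_bounded_linear/mx_bounded_trace_col_proj.
transitivity (mxintegral mu (fun V : unitary R d => \sum_j \sum_k
    (\tr (X *m col_proj k V) *: (al j k)%:M +
     be j k *: tau (\tr (X *m col_proj k V) *: col_proj j V)))).
  congr mxintegral; apply/funext => V /=.
  transitivity (mxintegral mu (fun U : unitary R d => \sum_(j < d) \sum_(k < d)
      \tr (X *m col_proj k (unitary_val V)) *:
      (\tr (tau (col_proj j (unitary_val V)) *m col_proj j U) *: col_proj k U))).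
    congr mxintegral; apply/funext => U.
    rewrite superop_inner_twisted twisted_dephasingE scaler_suml.
    apply: eq_bigr => j _; rewrite scaler_sumr; apply: eq_bigr => k _.
    by rewrite !scalerA mulrC.
  have bjk (j k : 'I_d) : mx_bounded (fun U : unitary R d =>
      \tr (X *m col_proj k (unitary_val V)) *:
      (\tr (tau (col_proj j (unitary_val V)) *m col_proj j U) *: col_proj k U)).
    by apply: mx_boundedZ; [exact: bounded_mfun_cst
                           |exact: mx_bounded_trace_col_proj].
  rewrite mxintegral_sum // => [|j]; last exact: mx_bounded_sum.
  apply: eq_bigr => j _; rewrite mxintegral_sum //; apply: eq_bigr => k _.
  rewrite mxintegralZ ?mxintegral_col_proj2 //; last first.
    exact: mx_bounded_trace_col_proj.
  (* Trace preservation enters here: the average over U produces tr(tau(Q_j(V))), which equals tr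
     Q_j(V) = 1. *)
  rewrite tau_tp mxtrace_col_proj ?unitary_valP // mulr1 scalerDr.
  by rewrite [in RHS]linearZ /= !scalerA [be j k * _]mulrC.
have bjk j k : mx_bounded (fun V : unitary R d =>
    \tr (X *m col_proj k V) *: (al j k)%:M +
     be j k *: tau (\tr (X *m col_proj k V) *: col_proj j V)).
  apply: mx_boundedD; apply: mx_boundedZ => //.
    exact: mx_bounded_cst.
  exact: bounded_mfun_cst.
rewrite mxintegral_sum // => [|j]; last exact: mx_bounded_sum.
apply: eq_bigr => j _; rewrite mxintegral_sum //; apply: eq_bigr => k _.
rewrite mxintegralD //; first last.
- by apply: mx_boundedZ => //; exact: bounded_mfun_cst.
- by apply: mx_boundedZ => //; exact: mx_bounded_cst.
rewrite mxintegral_scalel // cintegral_trace_col_proj mxintegralZ //.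
rewrite mxintegral_linear; [|exact: mu_lty|exact: mx_bounded_trace_col_proj].
rewrite mxintegral_col_proj2.
(* The average over V tests X against Q_k and keeps Q_j, so the coefficients appear with j and k
   exchanged. *)
have -> : al k j = al j k by rewrite /weingarten_id eq_sym.
have -> : be k j = be j k by rewrite /weingarten_swap eq_sym.
(* Unitality enters here: tau fixes multiples of the identity. *)
have -> : tau ((al j k * \tr X)%:M + be j k *: X) =
    (al j k * \tr X)%:M + be j k *: tau X.
  by rewrite linearD linearZ -scalemx1 linearZ /= tau1.
rewrite scalerDr scalerA !scale_scalar_mx addrA -raddfD /=.
by congr (_%:M + _ *: _); ring.
Qed.

End TwistedDephasingMean.

(** * Evaluation of the constants and the integral representation *)

Lemma weingarten_sums {R : realType} {d : nat} (t : R[i]) : (1 < d)%N ->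
  \sum_(j < d) \sum_(k < d)
    weingarten_id j k * (d%:R^-1 + weingarten_swap j k) * t =
  ((d%:R - 1) * (d%:R + 1) ^+ 2)^-1 *
    (((d%:R - 1) * (d%:R + 1) ^+ 2 - 1) * (t / d%:R)) /\
  \sum_(j < d) \sum_(k < d) weingarten_swap j k ^+ 2 =
  ((d%:R - 1) * (d%:R + 1) ^+ 2)^-1 :> R[i].
Proof.
move=> d_gt1.
have d_neq0 : d%:R != 0 :> R[i] by rewrite pnatr_eq0 -lt0n ltnW.
have dB_neq0 : d%:R - 1 != 0 :> R[i].
  by rewrite subr_eq0 -[1]/(1%:R) eqr_nat gtn_eqF.
have dD_neq0 : d%:R + 1 != 0 :> R[i] by rewrite natr1 pnatr_eq0.
have dd : d%:R ^+ 2 - 1 = (d%:R - 1) * (d%:R + 1) :> R[i] by ring.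
(* The summands depend on j and k only through whether they agree, which happens for d pairs and
   fails for d (d - 1). *)
have sumE (F : bool -> R[i]) : \sum_(j < d) \sum_(k < d) F (j == k) =
    d%:R * F true + d%:R * (d%:R - 1) * F false.
  transitivity (\sum_(j < d) (F true + (d%:R - 1) * F false)).
    apply: eq_bigr => j _; rewrite (bigD1 j) //= eqxx; congr (_ + _).
    rewrite (eq_bigr (fun=> F false)) => [|k kj]; last first.
      by rewrite eq_sym (negbTE kj).
    rewrite sumr_const cardC1 card_ord -[LHS]mulr_natl.
    by rewrite -subn1 natrB // ltnW.
  by rewrite sumr_const card_ord -[LHS]mulr_natl; ring.
split.
  rewrite (sumE (fun b => (d%:R - b%:R) / (d%:R * (d%:R ^+ 2 - 1)) *
    (d%:R^-1 + (d%:R * b%:R - 1) / (d%:R * (d%:R ^+ 2 - 1))) * t)) /= dd.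
  by field; rewrite d_neq0 dB_neq0 dD_neq0.
rewrite (sumE (fun b => ((d%:R * b%:R - 1) / (d%:R * (d%:R ^+ 2 - 1))) ^+ 2)) /= dd.
by field; rewrite d_neq0 dB_neq0 dD_neq0.
Qed.

Theorem theorem4p1 (R : realType) (d : nat)
    (mu : probability (unitary R d) R) (mu_haar : haar_measure mu)
    (tau : {linear 'M[R[i]]_d -> 'M[R[i]]_d})
    (tau_channel : quantum_channel tau) (tau_unital : unital tau) :
  let weight (p : unitary R d * unitary R d) : R[i] :=
    (d%:R - 1) * (d%:R + 1) ^+ 2
      * superop_inner (twisted_dephasing p.1 p.2) tau
    - (d%:R - 1) * (d%:R + 1) ^+ 2 + 1 in
  let integrand (p : unitary R d * unitary R d) (X : 'M[R[i]]_d) :=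
    weight p *: twisted_dephasing p.1 p.2 X in
  [/\ forall p, weight p \is Num.real,
      superop_integrable (mu \x mu)%E integrand
    & tau =1 superop_integral (mu \x mu)%E integrand].
Proof.
have [tau_cp tau_tp] := tau_channel.
set K : R[i] := (d%:R - 1) * (d%:R + 1) ^+ 2.
move=> weight integrand.
have bweight : bounded_mfun weight.
  apply: bounded_mfunD; last exact: bounded_mfun_cst.
  apply: bounded_mfunD; last exact: bounded_mfun_cst.
  apply: bounded_mfunM; first exact: bounded_mfun_cst.
  exact: bounded_mfun_superop_inner.
have bintegrand X : mx_bounded (fun p => integrand p X).
  by apply: mx_boundedZ => //; exact: mx_bounded_twisted_dephasing.
split.
- move=> p; have K_real : K \is Num.real.
    by rewrite rpredM ?rpredX ?rpredB ?rpredD ?rpred1 ?realn.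
  rewrite rpredD ?rpred1 // rpredB // rpredM //.
  exact: superop_inner_twisted_real.
- move=> X i j; apply: bounded_mfun_cintegrable; last exact: bintegrand.
  exact: product_measure1_lty.
move=> X; rewrite -[RHS]/(mxintegral (mu \x mu)%E (fun p => integrand p X)).
(* The moment formulas require d > 1. For d = 0 matrices have no entries. For d = 1 the constant [K]
   is 0 and the weight is 1, while [tau] and every twisted dephasing are the identity. *)
have [d_gt1|d_le1] := ltnP 1 d; last first.
  have [d0|d1] : d = 0%N \/ d = 1%N by case: (d) d_le1 => [|[|]] //; auto.
    by apply/matrixP => i; have := ltn_ord i; rewrite [X in (_ < X)%N]d0.
  subst d; transitivity X.
    by rewrite (mx11_scalar X) -scalemx1 linearZ /= tau_unital.
  transitivity (mxintegral (mu \x mu)%E (fun _ : unitary R 1 * unitary R 1 => X)).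
    rewrite mxintegral_fubini; last exact: mx_bounded_cst.
    by rewrite !mxintegral_cst.
  congr mxintegral; apply/funext => p.
  rewrite /integrand /weight /K subrr !mul0r subr0 add0r scale1r.
  by rewrite twisted_dephasing_dim1.
pose inner (p : unitary R d * unitary R d) :=
  superop_inner (twisted_dephasing p.1 p.2) tau *: twisted_dephasing p.1 p.2 X.
have binner : mx_bounded inner.
  by apply: mx_boundedZ; [exact: bounded_mfun_superop_inner
                         |exact: mx_bounded_twisted_dephasing].
have btwist := mx_bounded_twisted_dephasing X.
have mu2_lty := product_measure1_lty mu mu.
(* The weight is [K] times the inner product plus the constant [1 - K], so the integral splits into
   the two averages already computed. *)
transitivity (mxintegral (mu \x mu)%E (fun p : unitary R d * unitary R d =>
    K *: inner p + (1 - K) *: twisted_dephasing p.1 p.2 X)); last first.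
  congr mxintegral; apply/funext => p; rewrite /integrand /weight /inner scalerA.
  by rewrite -scalerDl; congr (_ *: _); ring.
rewrite mxintegralD //; first last.
- by apply: mx_boundedZ => //; exact: bounded_mfun_cst.
- by apply: mx_boundedZ => //; exact: bounded_mfun_cst.
rewrite !mxintegralZ // mxintegral_twisted_dephasing //.
rewrite mxintegral_superop_inner //.
have [Sid Sswap] := weingarten_sums (\tr X) d_gt1.
have K_neq0 : K != 0.
  apply: mulf_neq0; last by apply: expf_neq0; rewrite natr1 pnatr_eq0.
  by rewrite subr_eq0 -[1]/(1%:R) eqr_nat gtn_eqF.
have -> : \sum_(j < d) \sum_(k < d)
    ((weingarten_id j k * (d%:R^-1 + weingarten_swap j k) * \tr X)%:M +
     weingarten_swap j k ^+ 2 *: tau X) =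
    (K^-1 * ((K - 1) * (\tr X / d%:R)))%:M + K^-1 *: tau X.
  rewrite -Sid -Sswap scaler_suml raddf_sum -big_split /=.
  apply: eq_bigr => j _; rewrite scaler_suml raddf_sum -big_split /=.
  by [].
(* Multiplication by [K] turns the first average into [tau X] plus (K - 1) tr(X)/d times the
   identity, and the second average contributes the opposite multiple. *)
rewrite scalerDr scalerA divff // scale1r !scale_scalar_mx mulVKf //.
rewrite addrAC -raddfD /= (_ : _ + _ = 0) ?raddf0 ?add0r //.
by ring.
Qed.
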